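(* Let $M$ and $N$ be oriented, $n$-dimensional (smooth) manifolds with volume forms $\mu_M$ and $\mu_N$, respectively, and let $\varphi\colon M\to N$ be an orientation-preserving diffeomorphism with Jacobian determinant $J(\mu_M,\mu_N)\varphi\in C^\infty(M)$. Then, for any smooth density $u\mu_M\in\Omega^n(M)$, where $u\in C^\infty(M)$ has compact support $\operatorname{supp}u=\operatorname{supp}u\mu_M$, $$\bigl\lVert \mathbf{1}_{\operatorname{supp}u\mu_M}[J(\mu_M,\mu_N)\varphi]^{1/q}\bigr\rVert_\infty^{-1}\lVert u\mu_M\rVert_p\;\le\;\lVert\varphi_*(u\mu_M)\rVert_p\;\le\;\bigl\lVert \mathbf{1}_{\operatorname{supp}u\mu_M}[J(\mu_M,\mu_N)\varphi]^{-1/q}\bigr\rVert_\infty\lVert u\mu_M\rVert_p$$ for all $p,q\in[1,\infty]$ such that $1/p+1/q=1$.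
   Context: A volume form on an oriented $n$-manifold is a smooth $n$-form that is everywhere positive with respect to the orientation. The Jacobian determinant $J(\mu_M,\mu_N)\varphi\in C^\infty(M)$ is the (positive) function determined by $\varphi^*\mu_N=[J(\mu_M,\mu_N)\varphi]\,\mu_M$. Functions are real-valued. A density on $M$ is an $n$-form, written $u\mu_M$; its pointwise norm is $|u\mu_M|=|u|$, and similarly $|v\mu_N|=|v|$ on $N$. The $L^p$-norm of a density is $\lVert u\mu_M\rVert_p=\bigl(\int_M|u\mu_M|^p\mu_M\bigr)^{1/p}$ for $p<\infty$ (essential supremum of $|u|$ for $p=\infty$), and likewise on $N$ using $\mu_N$. For functions, $\lVert\cdot\rVert_\infty$ is the essential supremum norm. The pushforward is $\varphi_*=(\varphi^{-1})^*$. $\mathbf{1}_S$ is the indicator function of $S$. Convention: $1/\infty=0$. In the degenerate case $u=0$, the left-hand side is read as $0$. *)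

(* Defs.v *)
From HB Require Import structures.
From mathcomp Require Import all_boot all_order all_algebra.
From mathcomp Require Import all_classical all_reals all_analysis.
From mathcomp Require Import measurable_realfun.

Set Implicit Arguments.
Unset Strict Implicit.
Unset Printing Implicit Defensive.

Import Order.TTheory GRing.Theory Num.Theory.
Import numFieldNormedType.Exports.

Local Open Scope classical_set_scope.
Local Open Scope ring_scope.

Definition borel (T : ptopologicalType) := g_sigma_algebraType (@open T).
HB.instance Definition _ (T : ptopologicalType) := Measurable.on (borel T).

Lemma continuous_measurable_borel (S T : ptopologicalType) (D : set (borel S))
    (f : borel S -> borel T) :
  open (D : set S) -> (forall x, D x -> {for x, continuous (f : S -> T)}) ->
  measurable_fun D f.
Proof.
move=> oD cf.
refine (@measurability _ _ _ _ D f (@open T) erefl _).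
move=> _ [B oB <-]; apply: sub_sigma_algebra.
suff : open (D `&` f @^-1` B : set S) by [].
rewrite openE => x [Dx Bfx]; apply: filterI; first exact: open_nbhs_nbhs.
by apply: (cf x Dx); exact: open_nbhs_nbhs.
Qed.

Lemma continuous_measurable_R (R : realType) (S : ptopologicalType) (D : set (borel S))
    (f : borel S -> measurableTypeR R) :
  open (D : set S) -> (forall x, D x -> {for x, continuous (f : S -> R)}) ->
  measurable_fun D f.
Proof.
move=> oD cf.
refine (@measurability _ _ _ _ D f _ (RGenOpens.measurableE R) _).
move=> _ [_ [a [b ->]] <-]; apply: sub_sigma_algebra.
suff : open (D `&` f @^-1` `]a, b[ : set S) by [].
rewrite openE => x [Dx Bfx]; apply: filterI; first exact: open_nbhs_nbhs.
by apply: (cf x Dx); apply: open_nbhs_nbhs; split => //; exact: interval_open.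
Qed.

Lemma sigma_finite_prod d1 d2 (T1 : measurableType d1) (T2 : measurableType d2)
    (R : realType) (m1 : {sigma_finite_measure set T1 -> \bar R})
    (m2 : {sigma_finite_measure set T2 -> \bar R}) :
  sigma_finite setT (m1 \x m2)%E.
Proof.
have /sigma_finiteP[F [TF ndF Foo]] := sigma_finiteT m1.
have /sigma_finiteP[G [TG ndG Goo]] := sigma_finiteT m2.
exists (fun n => F n `*` G n) => [|k].
  rewrite -setXTT TF TG; apply/seteqP; split => [[x y]|[x y] [n _ []]] /=.
    move=> [[i _ Fx] [j _ Gy]]; exists (maxn i j) => //; split.
      by move: x Fx; exact/subsetPset/ndF/leq_maxl.
    by move: y Gy; exact/subsetPset/ndG/leq_maxr.
  by move=> Fx Gy; split; exists n.
have [? ?] := Foo k; have [? ?] := Goo k.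
split; first exact: measurableX.
by rewrite product_measure1E// lte_mul_pinfty// ge0_fin_numE.
Qed.

Section lebesgue_rV.
Variable R : realType.

Definition consrV n (tv : measurableTypeR R * borel 'rV[R]_n) :
  borel 'rV[R]_n.+1 := row_mx (tv.1)%:M tv.2 : 'rV[R]_(1 + n).

Lemma measurable_consrV n : measurable_fun setT (@consrV n).
Proof.
refine (@measurability _ _ _ _ setT (@consrV n) (@open 'rV[R]_n.+1) erefl _).
move=> _ [W oW <-]; rewrite setTI.
pose r (i : nat) : R := i.+1%:R^-1.
have r0 i : 0 < r i by rewrite /r invr_gt0.
pose box (i : rat * 'rV[rat]_n * nat) :
    set (measurableTypeR R * borel 'rV[R]_n) :=
  ball (ratr i.1.1 : R) (r i.2) `*` ball (map_mx ratr i.1.2 : 'rV[R]_n) (r i.2).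
have -> : @consrV n @^-1` W =
    \bigcup_i (if `[< box i `<=` @consrV n @^-1` W >] then box i else set0).
  apply/seteqP; split => [[t v] Wtv|tv [i _]]; last first.
    by case: asboolP => // bi /bi.
  have /nbhs_ballP[e e0 eW] := open_nbhs_nbhs (conj oW Wtv).
  have [k ke] : exists k, r k + r k < e.
    have e20 : 0 < e / 2 by rewrite divr_gt0.
    have [k _ /(_ k (leqnn k))] := near_infty_natSinv_lt (PosNum e20).
    by move=> /= ke; exists k; rewrite (splitr e) ltrD.
  have appr (x : R) : exists q : rat, ball (ratr q : R) (r k) x.
    have xr : x - r k < x by rewrite ltrBlDr ltrDl.
    have [q] := rat_in_itvoo xr; rewrite in_itv/= => /andP[q1 q2].
    by exists q; rewrite /ball/= ltr_distl q1 (lt_trans q2)// ltrDl.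
  have [a ta] := appr t.
  have [q qv] := choice (fun j => appr (v 0 j)).
  exists (a, \row_j q j, k) => //.
  have tvbox : box (a, \row_j q j, k) (t, v).
    by split => //=; split => // i j; rewrite !mxE !ord1.
  case: asboolP => // nb; exfalso; apply: nb => -[s w] [/= ps pw]; apply: eW.
  rewrite -/(ball _ _ _); split => // i j.
  rewrite /consrV/= !mxE; case: splitP => l _.
    rewrite !mxE !ord1 eqxx !mulr1n.
    exact/(le_ball (ltW ke))/(ball_triangle (ball_sym ta)).
  have [_ /(_ 0 l)] := pw; rewrite !mxE !ord1 => qw.
  exact/(le_ball (ltW ke))/(ball_triangle (ball_sym (qv l))).
apply: countable_bigcupT_measurable => // i; case: ifP => // _.
apply: measurableX; first exact: measurable_ball.
by apply: sub_sigma_algebra; exact: ball_open.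
Qed.

Section step.
Context n (m : {sigma_finite_measure set (borel 'rV[R]_n) -> \bar R}).


Definition lebesgueS : set (borel 'rV[R]_n.+1) -> \bar R :=
  pushforward (@lebesgue_measure R \x m)%E (@consrV n).

HB.instance Definition _ := Measure.copy lebesgueS
  (measure_function_pushforward__canonical__measure_function_Measure
     (@lebesgue_measure R \x m)%E (@measurable_consrV n)).

Let sigma_finite_lebesgueS : sigma_finite setT lebesgueS.
Proof.
have [H UH mH] : sigma_finite setT (@lebesgue_measure R \x m)%E.
  exact: sigma_finite_prod.
pose d : borel 'rV[R]_n.+1 -> measurableTypeR R * borel 'rV[R]_n :=
  fun w => ((w : 'rV[R]_(1 + n)) 0 (lshift n 0), rsubmx (w : 'rV[R]_(1 + n))).
have md : measurable_fun setT d.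
  apply: measurable_fun_pair.
    apply: continuous_measurable_R => [|x _]; first exact: openT.
    exact: coord_continuous.
  apply: continuous_measurable_borel => [|x _]; first exact: openT.
  exact: continuous_rsubmx.
have dK tv : d (consrV tv) = tv.
  case: tv => t v; rewrite /d /consrV row_mxKr; congr pair.
  by rewrite row_mxEl mxE.
exists (fun i => d @^-1` H i).
  by rewrite -preimage_bigcup -UH preimage_setT.
move=> i; have [mHi Hioo] := mH i; split.
  by rewrite -[X in measurable X]setTI; exact: md.
by rewrite /lebesgueS /pushforward -comp_preimage (_ : d \o _ = id)//; exact/funext.
Qed.

HB.instance Definition _ := Measure_isSigmaFinite.Build _ _ _ lebesgueS
  sigma_finite_lebesgueS.
End step.

(* Lebesgue measure on R^n: the n-fold product of Lebesgue measure on R, carried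
   to row vectors; for n = 0 it is the unit mass of the one-point space. *)
Fixpoint lebesgue_rV n : {sigma_finite_measure set (borel 'rV[R]_n) -> \bar R} :=
  if n is n'.+1 then lebesgueS (lebesgue_rV n') else \d_(0 : borel 'rV[R]_0).

End lebesgue_rV.
Search "pushforward" "canonical".

Section smooth_maps.
Context (R : realType) (V W : normedModType R).

(* f is of class C^k on U, to be used with U open. *)
Fixpoint Ck_on (k : nat) (U : set V) (f : V -> W) : Prop :=
  if k is k'.+1 then
    (forall a, U a -> differentiable f a) /\ (forall v, Ck_on k' U ('D_v f))
  else forall a, U a -> {for a, continuous f}.

Definition smooth_on (U : set V) (f : V -> W) := forall k, Ck_on k U f.

End smooth_maps.

(* cmap and cinv are total functions, but only their restrictions to cdom and to
   cmap @` cdom carry information; these are mutually inverse homeomorphisms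
   between open sets. *)
Record chart (R : realType) (n : nat) (T : topologicalType) := Chart {
  cdom : set T ;
  cmap : T -> 'rV[R]_n ;
  cinv : 'rV[R]_n -> T ;
  open_cdom : open cdom ;
  open_cmap : open (cmap @` cdom) ;
  cmapK : forall p, cdom p -> cinv (cmap p) = p ;
  cmap_continuous : forall p, cdom p -> {for p, continuous cmap} ;
  cinv_continuous : forall v, (cmap @` cdom) v -> {for v, continuous cinv} }.

Definition compatible (R : realType) n (T : topologicalType)
    (x y : chart R n T) :=
  smooth_on (cmap x @` (cdom x `&` cdom y)) (cmap y \o cinv x) /\
  smooth_on (cmap y @` (cdom x `&` cdom y)) (cmap x \o cinv y).

(* The atlas is the maximal one, i.e. the whole smooth structure. The library's
   measurable types are pointed, hence manifolds are taken nonempty. *)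
Record manifold (R : realType) (n : nat) := Manifold {
  carrier :> ptopologicalType ;
  manifold_hausdorff : hausdorff_space carrier ;
  manifold_second_countable : @second_countable carrier ;
  atlas : set (chart R n carrier) ;
  atlas_cover : forall p, exists x, atlas x /\ cdom x p ;
  atlas_compatible : forall x y, atlas x -> atlas y -> compatible x y ;
  atlas_maximal : forall x, (forall y, atlas y -> compatible x y) -> atlas x }.

Definition chart_at (R : realType) n (M : manifold R n) (p : M) :
  chart R n M := projT1 (cid (atlas_cover p)).

Definition local_rep (R : realType) n (M N : manifold R n)
    (x : chart R n M) (y : chart R n N) (phi : M -> N) : 'rV[R]_n -> 'rV[R]_n :=
  cmap y \o phi \o cinv x.

(* orient x p is the sign (+1 or -1) of the coordinate frame of the chart x at p.
   The charts of the maximal atlas include orientation-reversing ones; moreover,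
   for n = 0 an orientation is an arbitrary choice of sign at each point. *)
Record oriented_manifold (R : realType) (n : nat) := OrientedManifold {
  manifold_of :> manifold R n ;
  orient : chart R n manifold_of -> manifold_of -> R ;
  orient_sign : forall x p, atlas x -> cdom x p ->
    orient x p = 1 \/ orient x p = -1 ;
  orient_continuous : forall x p, atlas x -> cdom x p ->
    \forall q \near p, orient x q = orient x p ;
  orient_compatible : forall x y p, atlas x -> atlas y -> cdom x p -> cdom y p ->
    orient x p = Num.sg (\det ('J (cmap y \o cinv x) (cmap x p))) * orient y p }.

Section smooth.
Context (R : realType) (n : nat) (M N : manifold R n).

Definition smooth_fun (f : M -> R) := forall x, atlas x ->
  smooth_on (cmap x @` cdom x) (f \o cinv x).

Definition smooth_map (phi : M -> N) := continuous phi /\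
  forall (x : chart R n M) (y : chart R n N), atlas x -> atlas y ->
  smooth_on (cmap x @` (cdom x `&` phi @^-1` cdom y)) (local_rep x y phi).

End smooth.

Record diffeomorphism (R : realType) n (M N : manifold R n) := Diffeomorphism {
  diffeo :> M -> N ;
  diffeoV : N -> M ;
  diffeoK : cancel diffeo diffeoV ;
  diffeoVK : cancel diffeoV diffeo ;
  diffeo_smooth : smooth_map diffeo ;
  diffeoV_smooth : smooth_map diffeoV }.

Definition orientation_preserving (R : realType) n (M N : oriented_manifold R n)
    (phi : M -> N) :=
  forall (x : chart R n M) (y : chart R n N) (p : M),
  atlas x -> atlas y -> cdom x p -> cdom y (phi p) ->
  orient x p = Num.sg (\det ('J (local_rep x y phi) (cmap x p))) * orient y (phi p).

Section forms.
Context (R : realType) (n : nat).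
Implicit Types M N : manifold R n.

(* An n-form is given by its representatives in all charts: eta x p A is its value
   at p on the n tangent vectors whose coordinates in the chart x are the rows of
   A. The library's Jacobian acts on row vectors, v |-> v *m 'J f a, so that
   A *m 'J f a consists of the images of the rows of A under the differential.
   The type alone imposes nothing; see is_smooth_form. *)
Definition nform M := chart R n M -> M -> 'M[R]_n -> R.

Record alternating (f : 'M[R]_n -> R) : Prop := Alternating {
  alternating_linear : forall (A B C : 'M[R]_n) (i : 'I_n) (b c : R),
    row i A = b *: row i B + c *: row i C ->
    row' i B = row' i A -> row' i C = row' i A ->
    f A = b * f B + c * f C ;
  alternating0 : forall (A : 'M[R]_n) (i j : 'I_n),
    i != j -> row i A = row j A -> f A = 0 }.

Record is_smooth_form M (eta : nform M) : Prop := IsSmoothForm {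
  form_alternating : forall x p, atlas x -> cdom x p -> alternating (eta x p) ;
  form_compatible : forall x y p (A : 'M[R]_n),
    atlas x -> atlas y -> cdom x p -> cdom y p ->
    eta x p A = eta y p (A *m 'J (cmap y \o cinv x) (cmap x p)) ;
  form_smooth : forall x (A : 'M[R]_n), atlas x ->
    smooth_on (cmap x @` cdom x) (fun v => eta x (cinv x v) A) }.

Definition form_eq M (eta theta : nform M) :=
  forall x p, atlas x -> cdom x p -> eta x p = theta x p.

Definition mul_form M (u : M -> R) (eta : nform M) : nform M :=
  fun x p A => u p * eta x p A.

Definition form_support M (eta : nform M) : set M :=
  closure [set p | exists x A, [/\ atlas x, cdom x p & eta x p A != 0]].

(* By form_compatible the value does not depend on the chart taken around phi p. *)
Definition pullback M N (phi : M -> N) (eta : nform N) : nform M :=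
  fun x p A => let y := chart_at (phi p) in
    eta y (phi p) (A *m 'J (local_rep x y phi) (cmap x p)).

Definition pushforward_form M N (phi : diffeomorphism M N) (eta : nform M) :
  nform N := pullback (diffeoV phi) eta.

(* The function f determined by eta = f mu. It exists and is unique when eta is an
   n-form and mu is nowhere zero, as the n-forms at a point form a line. *)
Definition form_ratio M (eta mu : nform M) : M -> R :=
  xget (cst 0) [set f | form_eq eta (mul_form f mu)].

End forms.

Record volume_form (R : realType) n (M : oriented_manifold R n) := VolumeForm {
  volume_form_of :> nform M ;
  volume_form_smooth : is_smooth_form volume_form_of ;
  volume_form_gt0 : forall x p, atlas x -> cdom x p ->
    0 < orient x p * volume_form_of x p 1%:M }.

Section volume_measure.
Context (R : realType) (n : nat) (M : oriented_manifold R n).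
Variable mu : volume_form M.

(* The integral of mu over a Borel set B contained in the domain of x. Since mu is
   positive for the orientation, the absolute value is the coefficient of mu in
   the coordinates of x, taken with the sign of that coordinate frame. *)
Definition chart_volume (x : chart R n M) (B : set (borel M)) : \bar R :=
  (\int[lebesgue_rV R n]_(v in (cmap x @` B : set (borel 'rV[R]_n)))
     `|volume_form_of mu x (cinv x v) 1%:M|%:E)%E.

Definition chart_partition (A : set (borel M)) :
    set (nat -> chart R n M * set (borel M)) :=
  [set xB : nat -> chart R n M * set (borel M) |
    [/\ forall i, [/\ atlas (xB i).1, measurable (xB i).2 &
                      ((xB i).2 : set M) `<=` cdom (xB i).1],
        trivIset setT (fun i => (xB i).2) &
        A = \bigcup_i (xB i).2]].

(* The Borel measure A |-> \int_A mu. Split A into countably many Borel pieces, each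
   within a chart domain, and add up the integrals computed in these charts. By
   the change of variables formula, every splitting gives the same sum, so the
   infimum only selects this common value. *)
Definition volume (A : set (borel M)) : \bar R :=
  ereal_inf [set (\sum_(i <oo) chart_volume (xB i).1 (xB i).2)%E
            | xB in chart_partition A].

Let chart_volume_ge0 x B : (0 <= chart_volume x B)%E.
Proof. by apply: integral_ge0 => v _; rewrite lee_fin. Qed.

Let volume_ge0 A : (0 <= volume A)%E.
Proof.
by apply: le_ereal_inf_tmp => _ [xB _ <-]; apply: nneseries_ge0 => *.
Qed.

Let cmap_image (x : chart R n M) (B : set M) : B `<=` cdom x ->
  cmap x @` B = cmap x @` cdom x `&` cinv x @^-1` B.
Proof.
move=> Bx; apply/seteqP; split => [_ [p Bp <-]|_ [[p xp <-]]] /=.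
  by split; [exists p => //; exact: Bx|rewrite /= cmapK//; exact: Bx].
by rewrite cmapK// => Bp; exists p.
Qed.

Let measurable_cmap (x : chart R n M) (B : set (borel M)) :
  measurable B -> (B : set M) `<=` cdom x ->
  measurable (cmap x @` B : set (borel 'rV[R]_n)).
Proof.
move=> mB Bx; rewrite cmap_image//.
have /(_ _ B mB) := @continuous_measurable_borel _ _
  (cmap x @` cdom x) (cinv x) (@open_cmap _ _ _ x) (@cinv_continuous _ _ _ x).
by apply; apply: sub_sigma_algebra; exact: open_cmap.
Qed.

Let chart_volume_bigcup (x : chart R n M) (B : nat -> set (borel M)) :
  atlas x -> (forall k, measurable (B k)) -> trivIset setT B ->
  (forall k, (B k : set M) `<=` cdom x) ->
  chart_volume x (\bigcup_k B k) = (\sum_(k <oo) chart_volume x (B k))%E.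
Proof.
move=> ax mB tB Bx; rewrite /chart_volume image_bigcup.
rewrite ge0_integral_bigcup//; first by move=> k; exact: measurable_cmap.
  apply: (@measurable_funS _ _ _ _ (cmap x @` cdom x : set (borel 'rV[R]_n))).
  - by apply: sub_sigma_algebra; exact: open_cmap.
  - by apply: bigcup_sub => k _; exact/image_subset/Bx.
  apply/measurable_EFinP; apply: continuous_measurable_R => [|v xv].
    exact: open_cmap.
  apply: (@continuous_comp _ _ _ (fun v => volume_form_of mu x (cinv x v) 1%:M)).
    exact: (form_smooth (volume_form_smooth mu) 1%:M ax 0%N).
  exact: norm_continuous.
apply/trivIsetP => i j _ _ ij; apply/seteqP; split => // _ [[p Bp <-] [q Bq]].
move=> /(congr1 (cinv x)); rewrite !cmapK; [|exact: Bx Bp|exact: Bx Bq].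
move=> qp; have : (B i `&` B j) p by split => //; rewrite -qp.
by move/trivIsetP : tB => ->.
Qed.

Let volume0 : volume set0 = 0%E.
Proof.
apply/eqP; rewrite eq_le volume_ge0 andbT.
have [x [ax _]] := atlas_cover (point : M).
apply: ereal_inf_lbound; exists (fun=> (x, set0)).
  split => /= [_||]; last by rewrite bigcup0.
    by split => //; exact: measurable0.
  by move=> i j _ _ [p []].
by rewrite eseries0// => i _ _; rewrite /chart_volume image_set0 integral_set0.
Qed.

Let volume_bigcup (F : nat -> set (borel M)) :
  (forall k, measurable (F k)) -> trivIset setT F ->
  volume (\bigcup_k F k) = (\sum_(k <oo) volume (F k))%E.
Proof.
move=> mF tF; apply/eqP; rewrite eq_le; apply/andP; split; last first.
  apply: le_ereal_inf_tmp => _ [xB [xBP txB FxB] <-].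
  have -> : (\sum_(i <oo) chart_volume (xB i).1 (xB i).2 =
      \sum_(i <oo) \sum_(k <oo) chart_volume (xB i).1 ((xB i).2 `&` F k))%E.
    apply: eq_eseriesr => i _; have [ax mB Bx] := xBP i.
    rewrite -chart_volume_bigcup//; last 3 first.
    - by move=> k; exact: measurableI.
    - exact: trivIset_setIl.
    - by move=> k p [/Bx].
    congr chart_volume; rewrite -setI_bigcupr FxB; apply/esym/setIidl.
    by move=> p pB; exists i.
  rewrite nneseries_interchange//; apply: lee_nneseries => [*|k _].
    exact: volume_ge0.
  apply: ereal_inf_lbound; exists (fun i => ((xB i).1, (xB i).2 `&` F k)) => //.
  split => [i||] /=.
  - by have [ax mB Bx] := xBP i; split => //; [exact: measurableI|move=> p [/Bx]].
  - exact: trivIset_setIr.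
  - rewrite -setI_bigcupl -FxB; apply/esym/setIidr.
    by move=> p pB; exists k.
have [[i ioo]|] := pselect (exists i, volume (F i) = +oo%E).
  by rewrite (eseries_pinfty _ _ ioo) ?leey// => k _; rewrite -ltNye (lt_le_trans _ (volume_ge0 _)).
rewrite -forallNE => Foo; apply/lee_addgt0Pr => e e0.
apply: (le_trans _ (epsilon_trick _ _ (ltW e0))); last by [].
have /choice[G GP] k : exists xB, chart_partition (F k) xB /\
  (\sum_(i <oo) chart_volume (xB i).1 (xB i).2 <=
   volume (F k) + (e / (2 ^ k.+1)%:R)%:E)%E.
  have fk : volume (F k) \is a fin_num.
    by rewrite ge0_fin_numE// ltey; apply/eqP/Foo.
  have ek : 0 < e / (2 ^ k.+1)%:R by rewrite divr_gt0// ltr0n expn_gt0.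
  have [_ [xB xBF <-] /ltW xBe] := lb_ereal_inf_adherent ek fk.
  by exists xB.
have /card_esym/ppcard_eqP[f] := card_nat2.
pose g i := G (f i).1 (f i).2.
apply: (@le_trans _ _ (\sum_(k <oo) \sum_(i <oo) chart_volume (G k i).1 (G k i).2)%E); last first.
  by apply: lee_nneseries => [k _ _|k _]; [exact: nneseries_ge0|exact: (GP k).2].
apply: ereal_inf_lbound; exists g.
  split => [i||].
  - by have [[+ _ _] _] := GP (f i).1; exact.
  - apply/trivIsetP => i j _ _ ij; apply/seteqP; split => // p [pi pj].
    have pF k l : (G k l).2 p -> F k p.
      by have [[_ _ ->] _] := GP k; exists l.
    have fij1 : (f i).1 = (f j).1.
      apply/eqP/negPn/negP => nij.
      have : (F (f i).1 `&` F (f j).1) p by split; [exact: pF pi|exact: pF pj].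
      by move/trivIsetP : tF => ->.
    have fij2 : (f i).2 <> (f j).2.
      move=> fij2; have : f i = f j.
        by rewrite [LHS]surjective_pairing fij1 fij2 -surjective_pairing.
      move/(congr1 (f^-1%FUN)); rewrite !funK ?inE// => /eqP.
      by rewrite (negbTE ij).
    move: pi; rewrite /g fij1 => pi.
    have [[_ tG _] _] := GP (f j).1.
    have : ((G (f j).1 (f i).2).2 `&` (G (f j).1 (f j).2).2) p by [].
    by move/trivIsetP : tG => -> //; exact/eqP.
  - apply/seteqP; split => [p [k _]|p [i _ pi]].
      have [[_ _ ->] _] := GP k => -[l _ pl].
      by exists (f^-1%FUN (k, l)) => //; rewrite /g invK ?inE.
    exists (f i).1 => //; have [[_ _ ->] _] := GP (f i).1.
    by exists (f i).2.
rewrite nneseries_esumT//.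
under [RHS]eq_eseriesr do rewrite nneseries_esumT//.
rewrite nneseries_esumT; last by move=> k; exact: esum_ge0.
rewrite esum_esum//.
apply: esym; apply: (@reindex_esum _ _ _ setT _ f
  (fun k => chart_volume (G k.1 k.2).1 (G k.1 k.2).2)).
split=> // -[k l] _.
by exists (f^-1%FUN (k, l)) => //; rewrite invK ?inE.
Qed.

Let volume_sigma_additive : semi_sigma_additive volume.
Proof.
move=> F mF tF _; rewrite volume_bigcup//.
by apply: is_cvg_nneseries => *; exact: volume_ge0.
Qed.

HB.instance Definition _ := isMeasure.Build _ _ _ volume
  volume0 volume_ge0 volume_sigma_additive.


End volume_measure.

Definition jacobian_det (R : realType) n (M N : oriented_manifold R n)
    (muM : volume_form M) (muN : volume_form N) (phi : M -> N) : M -> R :=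
  form_ratio (pullback phi muN) muM.

(* The L^p-norm (1 <= p <= +oo) of the density eta = f mu, with |eta| = |f|. *)
Definition density_norm (R : realType) n (M : oriented_manifold R n)
    (mu : volume_form M) (p : \bar R) (eta : nform M) : \bar R :=
  ('N[volume mu]_p[EFin \o form_ratio eta mu])%E.

(* The norm may vanish; in \bar R, 0^-1 = +oo and +oo * 0 = 0. *)
Definition sup_norm (R : realType) n (M : oriented_manifold R n)
    (mu : volume_form M) (f : M -> R) : \bar R :=
  ('N[volume mu]_+oo[EFin \o f])%E.

(* Main.v *)
Require Import Defs.
From mathcomp Require Import all_boot all_order all_algebra.
From mathcomp Require Import perm.
From mathcomp Require Import all_classical all_reals all_analysis.
From mathcomp Require Import measurable_realfun ess_sup_inf.
Import Order.TTheory GRing.Theory Num.Theory.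
Import numFieldNormedType.Exports.
Local Open Scope classical_set_scope.
Local Open Scope ring_scope.

(** Write J for the Jacobian determinant of phi and psi for its inverse. The
    density phi_*(u mu_M) is the multiple (u / J) o psi of mu_N, so the change of
    variables a = psi b turns its norm, for finite p, into
      int_N |u / J|^p o psi mu_N = int_M |u|^p J^(1-p) mu_M
                                 = int_M |u J^(-1/q)|^p mu_M,
    and for p = oo it is the essential supremum of |u / J| = |u J^(-1/q)|, since
    phi preserves null sets. In all cases the norm of phi_*(u mu_M) is the L^p-norm
    of u J^(-1/q) (density_norm_pushforward). Both inequalities then follow from
    |f g|_p <= |f|_oo |g|_p (Lnorm_mul_le), applied to the products
    (1_S J^(-1/q)) u = u J^(-1/q) and (1_S J^(1/q)) (u J^(-1/q)) = u, where S is the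
    support of u.

    The change of variables on manifolds (change_of_variables) is obtained without
    the corresponding theorem in R^n. A chart y of N pulls back to the chart y o phi
    of M with the same image in R^n, and in these charts the coefficient of mu_N is
    J times that of mu_M. The volume of a set is an infimum over all its
    decompositions into pieces of chart domains; the decompositions of a subset of N
    pull back to decompositions of its preimage, whence
      a vol_M(A) <= vol_N(phi(A))   whenever a <= J on A   (volume_pull_le).
    Two measures related in this way satisfy int g J dvol_M <= int g o psi dvol_N
    (le_integral_density). The same inequality for psi, whose Jacobian determinant
    is 1 / J o psi (jacobian_inv), applied to (g J) o psi, is the opposite
    inequality.

    That J exists at all is the fact that alternating n-linear forms on R^n are
    multiples of the determinant (alternating_det). *)

Set Implicit Arguments.
Unset Strict Implicit.
Unset Printing Implicit Defensive.

(** * Comparison of integrals from comparison of measures *)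

Section measure_comparison.
Context d (T : measurableType d) (R : realType).
Variables m nu : {measure set T -> \bar R}.
Local Open Scope ereal_scope.
Import HBNNSimple.

(** A simple function below the extension by zero of [f] outside [A] has its nonzero
    levels inside [A], where the two measures are compared. *)
Lemma scaled_measure_le_integral (A : set T) (a : R) (f : T -> \bar R) :
  measurable A -> (0 <= a)%R ->
  (forall B, measurable B -> B `<=` A -> a%:E * m B <= nu B) ->
  measurable_fun A f -> (forall x, A x -> 0 <= f x) ->
  a%:E * \int[m]_(x in A) f x <= \int[nu]_(x in A) f x.
Proof.
move=> mA a0 mnu mf f0.
rewrite -(@ge0_integral_mscale _ _ _ m A mA (NngNum a0))//.
rewrite [leLHS]integral_mkcond [leRHS]integral_mkcond.
have fA0 x : 0 <= (f \_ A) x by rewrite erestrict_ge0.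
rewrite !ge0_integralTE//; apply: ge_ereal_sup => _ [h hfA <-].
apply: le_ereal_sup_tmp; exists (sintegral nu h); first by exists h.
rewrite !sintegralE lee_fsum// => r [t _ <-].
have [->|ht0] := eqVneq (h t) 0%R; first by rewrite !mul0e.
rewrite lee_wpmul2l ?lee_fin//; apply: mnu => // x hx.
apply: contrapT => Ax; have := hfA x.
rewrite patchE memNset// hx lee_fin leNgt lt0r ht0/=.
by move/negP; apply; exact: fun_ge0.
Qed.

(** This is the inequality J dm <= dnu of measures, with the hypothesis on [nu]
    expressing it on sets where J is bounded below by a constant. By monotone
    convergence J may be replaced by a simple function below it; on each of its
    levels the hypothesis then applies with the value of that function. *)
Lemma le_integral_density (J g : T -> R) :
  measurable_fun setT J -> (forall x, 0 <= J x)%R ->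
  (forall (a : R) A, measurable A -> (0 <= a)%R ->
     (forall x, A x -> a <= J x)%R -> a%:E * m A <= nu A) ->
  measurable_fun setT g -> (forall x, 0 <= g x)%R ->
  \int[m]_x (J x * g x)%:E <= \int[nu]_x (g x)%:E.
Proof.
move=> mJ J0 Jnu mg g0.
have mEJ : measurable_fun setT (EFin \o J) by exact/measurable_EFinP.
pose s := nnsfun_approx measurableT mEJ.
have cs x : EFin \o s ^~ x @ \oo --> (J x)%:E.
  by apply: cvg_nnsfun_approx => // y _; rewrite lee_fin.
have nds x : nondecreasing_seq (s ^~ x).
  by move=> i j ij; exact/lefP/nd_nnsfun_approx.
have sJ n x : (s n x <= J x)%R.
  by rewrite -lee_fin /s nnsfun_approxE; apply: le_approx => // y _; rewrite lee_fin.
have -> : \int[m]_x (J x * g x)%:E =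
    limn (fun n => \int[m]_x (s n x * g x)%:E).
  rewrite -monotone_convergence//.
  - apply: eq_integral => x _; apply/esym/cvg_lim => //.
    rewrite EFinM; under eq_fun do rewrite EFinM.
    apply: cvgeZr => //; exact: cs.
  - move=> n; apply/measurable_EFinP; exact: measurable_funM.
  - by move=> n x _; rewrite lee_fin mulr_ge0.
  - by move=> x _ i j ij; rewrite lee_fin ler_wpM2r//; exact: nds.
apply: lime_le.
  apply: ereal_nondecreasing_is_cvgn => i j ij; apply: ge0_le_integral => //.
  - by move=> x _; rewrite lee_fin mulr_ge0.
  - by apply/measurable_EFinP; exact: measurable_funM.
  - by apply/measurable_EFinP; exact: measurable_funM.
  - by move=> x _; rewrite lee_fin ler_wpM2r//; exact: nds.
apply: nearW => n.
pose levels : seq R := finmap.enum_fset (fset_set (range (s n))).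
have cover : \big[setU/set0]_(y <- levels) (s n @^-1` [set y]) = setT.
  apply/seteqP; split => // x _; rewrite -bigcup_seq; exists (s n x) => //=.
  by rewrite in_fset_set// inE; exists x.
have trivL : trivIset [set` levels] (fun y => s n @^-1` [set y]).
  by apply/trivIsetP => y z _ _ /eqP yz; apply/seteqP; split => // x [/= -> ].
have mgn : measurable_fun setT (fun x => (s n x * g x)%:E).
  by apply/measurable_EFinP; exact: measurable_funM.
rewrite -cover ge0_integral_bigsetU ?finmap.fset_uniq ?cover//; last first.
  by move=> x _; rewrite lee_fin mulr_ge0.
rewrite -[in leRHS]cover ge0_integral_bigsetU ?finmap.fset_uniq ?cover//; last 2 first.
- exact/measurable_EFinP.
- by move=> x _; rewrite lee_fin.
apply: lee_sum => y _.
have [y0|y0] := leP 0%R y; last first.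
  have -> : s n @^-1` [set y] = set0.
    apply/seteqP; split => // x /= xy.
    by move: y0; rewrite -xy ltNge fun_ge0.
  by rewrite !integral_set0.
apply: (@le_trans _ _ (y%:E * \int[m]_(x in s n @^-1` [set y]) (g x)%:E)).
  rewrite -ge0_integralZl_EFin//.
  - by rewrite (eq_integral (fun x => y%:E * (g x)%:E))// => x /[!inE] /= ->.
  - by move=> x _; rewrite lee_fin.
  - exact/measurable_EFinP/measurable_funTS.
apply: scaled_measure_le_integral => //.
- by move=> B mB By; apply: Jnu => // x /By /= <-.
- exact/measurable_EFinP/measurable_funTS.
- by move=> x _; rewrite lee_fin.
Qed.
End measure_comparison.

(** * The norm of a product *)

Section norm_of_product.
Context d (T : measurableType d) (R : realType) (m : {measure set T -> \bar R}).
Local Open Scope ereal_scope.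

(** The norm for p = +oo is set to 0 on a null space, where the bound still holds
    because every property holds almost everywhere. *)
Lemma ae_le_Lnormy (f : T -> \bar R) :
  \forall x \ae m, `|f x| <= 'N[m]_+oo[f].
Proof.
rewrite unlock; case: ifPn => [_|]; first exact: ess_sup_ge.
rewrite -leNgt => mT0; exists setT; split => //.
by apply/eqP; rewrite eq_le mT0 measure_ge0.
Qed.

(** |f g| is almost everywhere at most |f|_oo |g|. The bound is used in [\bar R], so
    that |f|_oo may be infinite, with +oo * 0 = 0 when g vanishes almost
    everywhere. *)
Lemma Lnorm_mul_le (p : \bar R) (f g : T -> R) : 0 < p ->
  measurable_fun setT f -> measurable_fun setT g ->
  'N[m]_p[EFin \o (fun x => f x * g x)%R] <=
  'N[m]_+oo[EFin \o f] * 'N[m]_p[EFin \o g].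
Proof.
move=> p0 mf mg; have fC := ae_le_Lnormy (EFin \o f).
set C := 'N[m]_+oo[EFin \o f] in fC *.
have C0 : 0 <= C by exact: Lnorm_ge0.
case: p p0 => [r| |//] r0; last first.
  rewrite [in leLHS]unlock; case: ifPn => [mT|_]; last by apply: mule_ge0 => //; exact: Lnorm_ge0.
  apply/ess_supP; have gC := ae_le_Lnormy (EFin \o g).
  near=> x; rewrite /= normrM EFinM lee_pmul ?lee_fin//.
    by near: x.
  by near: x.
rewrite lte_fin in r0.
have mpow (h : T -> R) : measurable_fun setT h ->
    measurable_fun setT (fun x => `|(h x)%:E| `^ r).
  move=> mh; apply: (@measurableT_comp _ _ _ _ _ _ (fun x => x `^ r)) => //=.
    exact: measurable_poweR.
  by apply/measurable_EFinP; exact: measurableT_comp.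
have -> : C * 'N[m]_r%:E[EFin \o g] =
    (\int[m]_x (C `^ r * `|(g x)%:E| `^ r)) `^ r^-1.
  rewrite ge0_integralZl//; last 3 first.
  - exact: mpow.
  - by move=> x _; apply: poweR_ge0.
  - exact: poweR_ge0.
  rewrite poweRM ?poweR_ge0//; last by apply: integral_ge0 => x _; exact: poweR_ge0.
  rewrite -poweRrM mulfV ?gt_eqF// poweRe1//.
  by rewrite [in LHS]unlock.
have mfg : measurable_fun setT (fun x => f x * g x)%R by exact: measurable_funM.
have powi0 (h : T -> R) : 0 <= \int[m]_x `|(h x)%:E| `^ r.
  by apply: integral_ge0 => x _; exact: poweR_ge0.
rewrite [in leLHS]unlock; apply: gt0_ler_poweR => //.
- by rewrite invr_ge0 ltW.
- by rewrite in_itv/= leey andbT powi0.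
- rewrite in_itv/= leey andbT; apply: integral_ge0 => x _.
  by rewrite mule_ge0// poweR_ge0.
apply: ae_ge0_le_integral => //.
- by move=> x _; exact: poweR_ge0.
- exact: mpow.
- by move=> x _; rewrite mule_ge0// poweR_ge0.
- by apply: emeasurable_funM => //; exact: mpow.
near=> x => _.
rewrite [X in X `^ _](_ : _ = `|(f x)%:E| * `|(g x)%:E|); last first.
  by rewrite /= normrM EFinM.
rewrite poweRM ?abse_ge0//.
rewrite lee_wpmul2r ?poweR_ge0//; apply: gt0_ler_poweR => //.
- exact: ltW.
- by rewrite in_itv/= leey andbT lee_fin.
- by rewrite in_itv/= leey andbT.
- by near: x.
Unshelve. all: by end_near. Qed.
End norm_of_product.

(** * Alternating forms are multiples of the determinant *)

Section alternating_forms.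
Context (R : realType) (n : nat).
Implicit Types (f : 'M[R]_n -> R) (A : 'M[R]_n).

Definition set_row A (i : 'I_n) (v : 'rV[R]_n) : 'M[R]_n :=
  \matrix_(k, j) if k == i then v 0 j else A k j.

Lemma row_set_row A i v : row i (set_row A i v) = v.
Proof. by apply/rowP => j; rewrite !mxE eqxx. Qed.

Lemma row_set_row_neq A i k v : k != i -> row k (set_row A i v) = row k A.
Proof. by move=> ki; apply/rowP => j; rewrite !mxE (negbTE ki). Qed.

Lemma set_row_row A i : set_row A i (row i A) = A.
Proof. by apply/matrixP => k j; rewrite !mxE; case: eqP => // ->. Qed.

Lemma row'_set_row A i v : row' i (set_row A i v) = row' i A.
Proof. by apply/matrixP => k j; rewrite !mxE eq_sym (negbTE (neq_lift _ _)). Qed.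

Lemma alternating_set_row f A i (b c : R) v w : Defs.alternating f ->
  f (set_row A i (b *: v + c *: w)) =
  b * f (set_row A i v) + c * f (set_row A i w).
Proof.
move=> fA; apply: (alternating_linear fA (i := i)).
- by rewrite !row_set_row.
- by rewrite !row'_set_row.
- by rewrite !row'_set_row.
Qed.

Lemma alternating_set_row_sum f A i (I : Type) (s : seq I) (b : I -> R)
    (v : I -> 'rV[R]_n) : Defs.alternating f ->
  f (set_row A i (\sum_(k <- s) b k *: v k)) =
  \sum_(k <- s) b k * f (set_row A i (v k)).
Proof.
move=> fA; elim: s => [|k s IHs]; rewrite ?big_nil ?big_cons.
  by have := alternating_set_row A i 0 0 0 0 fA; rewrite !scale0r !mul0r !addr0.
rewrite -IHs -[X in _ = _ + X]mul1r -alternating_set_row//.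
by rewrite scale1r.
Qed.

(** Vanishing on matrices with rows i and j both equal to a + b, and bilinearity in
    these two rows, give the change of sign. *)
Lemma alternating_xrow f A i j : Defs.alternating f -> i != j ->
  f (xrow i j A) = - f A.
Proof.
move=> fA ij; pose h v w := f (set_row (set_row A i v) j w).
have hh v : h v v = 0.
  apply: (alternating0 fA ij).
  by rewrite row_set_row row_set_row_neq// row_set_row.
have hDr v w1 w2 : h v (w1 + w2) = h v w1 + h v w2.
  by rewrite -[w1]scale1r -[w2]scale1r /h alternating_set_row// !scale1r !mul1r.
have set_rowC B v w :
    set_row (set_row B i v) j w = set_row (set_row B j w) i v.
  apply/matrixP => k l; rewrite !mxE; have [->|//] := eqVneq k j.
  by rewrite eq_sym (negbTE ij).
have hDl v1 v2 w : h (v1 + v2) w = h v1 w + h v2 w.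
  rewrite -[v1]scale1r -[v2]scale1r /h !set_rowC alternating_set_row//.
  by rewrite !scale1r !mul1r.
have := hh (row i A + row j A); rewrite hDr !hDl !hh add0r addr0.
move=> /eqP; rewrite addr_eq0 => /eqP hA.
have -> : f (xrow i j A) = h (row j A) (row i A).
  congr f; apply/matrixP => k l; rewrite !mxE.
  case: tpermP => [->|->|/eqP ki /eqP kj].
  - by rewrite (negbTE ij) eqxx.
  - by rewrite eqxx.
  - by rewrite (negbTE ki) (negbTE kj).
have -> : f A = h (row i A) (row j A).
  by rewrite /h set_row_row -[X in set_row X _ _](set_row_row A j) ; congr f;
    apply/matrixP => k l; rewrite !mxE; case: eqP => // ->.
by rewrite hA.
Qed.

(** Expanding the rows one after the other in the canonical basis reduces the claim
    to matrices whose rows are basis vectors. Such a matrix has two equal rows or is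
    a permutation matrix, and the latter is reached from 1 by exchanges of rows. *)
Lemma alternating_eq0 f A : Defs.alternating f -> f 1%:M = 0 -> f A = 0.
Proof.
move=> fA f1.
have f_perm (s : 'S_n) : f (perm_mx s) = 0.
  have [ts -> _] := prod_tpermP s.
  elim: ts => [|[i j] ts IHts]; first by rewrite big_nil perm_mx1.
  rewrite big_cons perm_mxM/= -/(tperm_mx i j) -xrowE.
  have [->|ij] := eqVneq i j; last by rewrite alternating_xrow// IHts oppr0.
  by rewrite /xrow tperm1 row_perm1.
(* Only the rows of index less than k remain to be expanded. *)
suff H k : (k <= n)%N -> forall B : 'M[R]_n,
    (forall i : 'I_n, (k <= i)%N -> exists c, row i B = delta_mx 0 c) -> f B = 0.
  by apply: (H n) => // i; rewrite leqNgt ltn_ord.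
elim: k => [_ B rB|k IHk kn B rB].
  have [s sE] := choice (fun i => rB i isT).
  have [/injectiveP injs|] := boolP (injectiveb s).
    rewrite (_ : B = perm_mx (perm injs))//.
    by apply/matrixP => i c; have /rowP/(_ c) := sE i; rewrite !mxE permE eq_sym.
  move=> /injectivePn[i [j ij sij]].
  by apply: (alternating0 fA ij); rewrite !sE sij.
have -> : B = set_row B (Ordinal kn) (row (Ordinal kn) B) by rewrite set_row_row.
rewrite [X in set_row _ _ X]row_sum_delta alternating_set_row_sum// big1// => c _.
rewrite IHk ?mulr0 ?(ltnW kn)// => i; rewrite leq_eqVlt => /predU1P[ki|ki].
  have -> : i = Ordinal kn by exact: val_inj.
  by exists c; rewrite row_set_row.
rewrite row_set_row_neq; first exact: rB.
by apply: contraTneq ki => ->; rewrite ltnn.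
Qed.

(** The difference of the two sides is an alternating form that vanishes at 1. *)
Lemma alternating_det f A : Defs.alternating f -> f A = \det A * f 1%:M.
Proof.
move=> fA; apply/eqP; rewrite -subr_eq0; apply/eqP.
apply: (@alternating_eq0 (fun B => f B - \det B * f 1%:M)).
  split => [B C D i b c BCD CB DB|B i j ij Bij].
    rewrite (alternating_linear fA BCD CB DB).
    rewrite (determinant_multilinear BCD CB DB).
    by rewrite !mulrDl !mulrBr opprD addrACA !mulrA.
  rewrite (alternating0 fA ij Bij) (determinant_alternate ij) ?mul0r ?subrr//.
  by move=> k; have /rowP/(_ k) := Bij; rewrite !mxE.
by rewrite det1 mul1r subrr.
Qed.

End alternating_forms.

(** * Charts pulled back along a diffeomorphism *)

Section pulled_back_charts.
Context (R : realType) (n : nat).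
Implicit Types M N : manifold R n.

Definition diffeo_inv M N (phi : diffeomorphism M N) : diffeomorphism N M :=
  Diffeomorphism (diffeoVK phi) (diffeoK phi) (diffeoV_smooth phi)
    (diffeo_smooth phi).

Lemma image_pulled_cdom M N (phi : diffeomorphism M N) (y : chart R n N)
    (D : set N) :
  (cmap y \o phi) @` (phi @^-1` D) = cmap y @` D.
Proof.
apply/seteqP; split => [_ [p Dp <-]|_ [b Db <-]]; first by exists (phi p).
by exists (diffeoV phi b); rewrite /= diffeoVK.
Qed.

Section pull_chart.
Context M N (phi : diffeomorphism M N) (y : chart R n N).

Let phi_continuous : continuous phi := (diffeo_smooth phi).1.
Let phiV_continuous : continuous (diffeoV phi) := (diffeoV_smooth phi).1.

Let open_pulled_cdom : open (phi @^-1` cdom y).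
Proof. by apply: open_comp; [move=> p _; exact: phi_continuous|exact: open_cdom]. Qed.

Let open_pulled_cmap : open ((cmap y \o phi) @` (phi @^-1` cdom y)).
Proof. by rewrite image_pulled_cdom; exact: open_cmap. Qed.

Let pulled_cmapK p : (phi @^-1` cdom y) p ->
  (diffeoV phi \o cinv y) ((cmap y \o phi) p) = p.
Proof. by move=> yp; rewrite /= cmapK// diffeoK. Qed.

Let pulled_cmap_continuous p : (phi @^-1` cdom y) p ->
  {for p, continuous (cmap y \o phi)}.
Proof.
by move=> yp; apply: continuous_comp; [exact: phi_continuous|exact: cmap_continuous].
Qed.

Let pulled_cinv_continuous v : ((cmap y \o phi) @` (phi @^-1` cdom y)) v ->
  {for v, continuous (diffeoV phi \o cinv y)}.
Proof.
rewrite image_pulled_cdom => yv.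
by apply: continuous_comp; [exact: cinv_continuous|exact: phiV_continuous].
Qed.

Definition pull_chart : chart R n M :=
  Chart open_pulled_cdom open_pulled_cmap pulled_cmapK pulled_cmap_continuous
    pulled_cinv_continuous.

(** Since the atlas is maximal, it suffices that [y o phi] be compatible with every
    chart of M, and the two transition maps are the local representatives of phi and
    of its inverse. *)
Lemma atlas_pull_chart : atlas y -> atlas pull_chart.
Proof.
move=> ay; apply: atlas_maximal => z az; split.
  have := (diffeoV_smooth phi).2 y z ay az.
  rewrite -(image_pulled_cdom phi) preimage_setI /=.
  rewrite -comp_preimage (_ : diffeoV phi \o phi = id)//.
  by apply/funext => p /=; rewrite diffeoK.
have := (diffeo_smooth phi).2 z y az ay.
by rewrite setIC.
Qed.

End pull_chart.

(** Pulling a chart back and forth only returns a chart with the same components, the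
    proof fields being different terms; proof irrelevance makes it equal to the
    original chart. *)
Lemma chart_eq M (x y : chart R n M) :
  cdom x = cdom y -> cmap x = cmap y -> cinv x = cinv y -> x = y.
Proof.
case: x y => [D f g ? ? ? ? ?] [D' f' g' ? ? ? ? ?] /= DD' ff' gg'.
by subst; congr Chart; exact: Prop_irrelevance.
Qed.

Lemma pull_chartK M N (phi : diffeomorphism M N) (x : chart R n M) :
  pull_chart phi (pull_chart (diffeo_inv phi) x) = x.
Proof.
have VK : diffeoV phi \o phi = id by apply/funext => p /=; rewrite diffeoK.
apply: chart_eq => /=.
- by rewrite -comp_preimage VK.
- by rewrite -compA VK.
- by rewrite compA VK.
Qed.

Lemma diffeo_invK M N (phi : diffeomorphism M N) :
  diffeo_inv (diffeo_inv phi) = phi.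
Proof. by case: phi. Qed.

(** In the chart of N that corresponds to [x] under phi, the map phi is the identity
    in coordinates. The values of a pullback can therefore be read off without any
    Jacobian matrix; the one in the definition of [pullback] is that of the change
    from this chart to the preferred chart at [phi p]. *)
Lemma pullbackE M N (phi : diffeomorphism M N) (eta : nform N)
    (x : chart R n M) (p : M) :
  is_smooth_form eta -> atlas x -> cdom x p ->
  pullback phi eta x p = eta (pull_chart (diffeo_inv phi) x) (phi p).
Proof.
move=> smooth_eta ax xp; apply/funext => A; rewrite /pullback.
have [ay yp] := projT2 (cid (atlas_cover (phi p))).
have ax' := atlas_pull_chart (diffeo_inv phi) ax.
have xp' : cdom (pull_chart (diffeo_inv phi) x) (phi p) by rewrite /= diffeoK.
apply/esym; apply: (etrans (form_compatible smooth_eta A ax' ay xp' yp)).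
rewrite -/(chart_at (phi p)).
by congr (eta _ _ (A *m 'J _ _)); rewrite /= diffeoK.
Qed.

End pulled_back_charts.

(** * Continuity of smooth functions and of coefficients of forms *)

Section smooth_functions_are_continuous.
Context (R : realType) (n : nat) (M : manifold R n).

Lemma continuous_in_chart (T : topologicalType) (f : M -> T)
    (x : chart R n M) (p : M) :
  cdom x p -> {for cmap x p, continuous (f \o cinv x)} -> {for p, continuous f}.
Proof.
move=> xp cf.
have cg : {for p, continuous (f \o cinv x \o cmap x)}.
  by apply: continuous_comp; [exact: cmap_continuous|exact: cf].
suff: f q @[q --> p] --> (f \o cinv x \o cmap x) p by rewrite /= cmapK.
apply: cvg_trans cg; apply: near_eq_cvg; near=> q.
by rewrite /= cmapK//; near: q; exact: (open_nbhs_nbhs (conj (open_cdom x) xp)).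
Unshelve. all: by end_near. Qed.

Lemma smooth_fun_continuous (u : M -> R) : smooth_fun u -> continuous u.
Proof.
move=> su p; have [x [ax xp]] := atlas_cover p.
by apply: (continuous_in_chart xp); apply: (su x ax 0%N); exists p.
Qed.

Lemma form_coefficient_continuous (eta : nform M) (x : chart R n M) (p : M) A :
  is_smooth_form eta -> atlas x -> cdom x p ->
  {for p, continuous (fun q => eta x q A)}.
Proof.
move=> se ax xp; apply: (continuous_in_chart xp).
by apply: (form_smooth se A ax 0%N); exists p.
Qed.

End smooth_functions_are_continuous.

(** * The Jacobian determinant *)

Section jacobian.
Context (R : realType) (n : nat).
Implicit Types M N : oriented_manifold R n.

Lemma form_det M (eta : nform M) (x : chart R n M) (p : M) A :
  is_smooth_form eta -> atlas x -> cdom x p ->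
  eta x p A = \det A * eta x p 1%:M.
Proof.
by move=> se ax xp; apply: alternating_det; exact: (form_alternating se).
Qed.

Lemma volume_form_neq0 M (mu : volume_form M) (x : chart R n M) (p : M) :
  atlas x -> cdom x p -> (mu : nform M) x p 1%:M != 0.
Proof.
move=> ax xp; apply: contraTneq (volume_form_gt0 mu ax xp) => ->.
by rewrite mulr0 ltxx.
Qed.

(** At every point a volume form is nonzero on the coordinate frame of some chart, so
    the ratio of a form to it is unique. *)
Lemma form_ratioE M (mu : volume_form M) (eta : nform M) (f : M -> R) :
  form_eq eta (mul_form f mu) -> form_ratio eta mu = f.
Proof.
move=> ef; rewrite /form_ratio.
have : form_eq eta (mul_form (form_ratio eta mu) mu).
  by rewrite /form_ratio; case: xgetP => [g _ //|/(_ f)].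
rewrite /form_ratio => eg; apply/funext => p.
have [x [ax xp]] := atlas_cover p.
have := congr1 (fun h => h 1%:M) (etrans (esym (eg x p ax xp)) (ef x p ax xp)).
by rewrite /mul_form => /(mulIf (volume_form_neq0 mu ax xp)).
Qed.

Context M N (muM : volume_form M) (muN : volume_form N).
Variable phi : diffeomorphism M N.
Let push_chart (x : chart R n M) : chart R n N := pull_chart (diffeo_inv phi) x.
Let J := jacobian_det muM muN phi.

(** The ratio is defined at each point with one chart. Under a change of chart, both
    forms are multiplied by the determinant of the same matrix, because corresponding
    charts of M and N have the same transition maps. *)
Lemma pullback_is_multiple :
  exists f, form_eq (pullback phi muN) (mul_form f muM).
Proof.
pose c (p : M) := chart_at p.
exists (fun p => (muN : nform N) (push_chart (c p)) (phi p) 1%:M /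
                 (muM : nform M) (c p) p 1%:M) => x p ax xp.
have [acp cp] := projT2 (cid (atlas_cover p)); rewrite -/(chart_at p) -/(c p) in acp cp.
rewrite pullbackE//; last exact: volume_form_smooth.
apply/funext => A; rewrite /mul_form.
have sN := volume_form_smooth muN; have sM := volume_form_smooth muM.
have push_dom z : cdom z p -> cdom (push_chart z) (phi p).
  by move=> zp; rewrite /= diffeoK.
rewrite (form_compatible sN A (atlas_pull_chart _ ax) (atlas_pull_chart _ acp)
  (push_dom _ xp) (push_dom _ cp)).
rewrite (form_compatible sM A ax acp xp cp).
rewrite (form_det (A *m _) sN (atlas_pull_chart _ acp) (push_dom _ cp)).
rewrite (form_det (A *m _) sM acp cp).
have cancel_b (d1 d2 a b : R) : b != 0 -> d1 = d2 -> d1 * a = a / b * (d2 * b).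
  by move=> b0 ->; rewrite mulrA -(mulrA a) (mulrC b^-1) mulrA mulfVK// mulrC.
apply: cancel_b; first exact: volume_form_neq0.
have -> : cmap (push_chart (c p)) \o cinv (push_chart x) = cmap (c p) \o cinv x.
  by apply/funext => v /=; rewrite diffeoK.
by rewrite /= diffeoK.
Qed.

Lemma jacobianP : form_eq (pullback phi muN) (mul_form J muM).
Proof.
by have [f fP] := pullback_is_multiple; rewrite /J /jacobian_det (form_ratioE fP).
Qed.

Lemma jacobianE (x : chart R n M) (p : M) : atlas x -> cdom x p ->
  (muN : nform N) (push_chart x) (phi p) 1%:M = J p * (muM : nform M) x p 1%:M.
Proof.
move=> ax xp; have := jacobianP ax xp.
rewrite pullbackE//; last exact: volume_form_smooth.
by move=> /(congr1 (fun h => h 1%:M)).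
Qed.

Lemma jacobian_continuous : continuous J.
Proof.
move=> p; have [x [ax xp]] := atlas_cover p.
pose g q := (muN : nform N) (push_chart x) (phi q) 1%:M / (muM : nform M) x q 1%:M.
have gJ q : cdom x q -> J q = g q.
  by move=> xq; rewrite /g jacobianE// mulfK// volume_form_neq0.
have cg : {for p, continuous g}.
  apply: cvgM; last first.
    apply: cvgV; first exact: volume_form_neq0.
    exact: form_coefficient_continuous (volume_form_smooth muM) ax xp.
  apply: (@continuous_comp _ _ _ phi
    (fun b => (muN : nform N) (push_chart x) b 1%:M)).
    exact: (diffeo_smooth phi).1.
  apply: form_coefficient_continuous; first exact: volume_form_smooth.
    exact: atlas_pull_chart.
  by rewrite /= diffeoK.
rewrite /continuous_at gJ//; apply: cvg_trans cg; apply: near_eq_cvg; near=> q.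
by rewrite gJ//; near: q; exact: (open_nbhs_nbhs (conj (open_cdom x) xp)).
Unshelve. all: by end_near. Qed.

(** For corresponding charts of M and N, phi is the identity in coordinates and
    preserves the signs of the coordinate frames, so the coefficients of the two
    volume forms have the same sign. *)
Lemma jacobian_gt0 p : orientation_preserving phi -> 0 < J p.
Proof.
move=> op; have [x [ax xp]] := atlas_cover p.
have ax' := atlas_pull_chart (diffeo_inv phi) ax.
have xp' : cdom (push_chart x) (phi p) by rewrite /= diffeoK.
have oM := volume_form_gt0 muM ax xp.
have oN := volume_form_gt0 muN ax' xp'.
rewrite jacobianE// in oN.
have same_orient : orient x p = orient (push_chart x) (phi p).
  (* The local representative is [cmap x o cinv x], whose sign also occurs in
     [orient_compatible] for the pair (x, x); it cancels. *)
  have := op _ _ _ ax ax' xp xp'; rewrite {1}(orient_compatible ax ax xp xp).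
  have -> : local_rep x (push_chart x) phi = cmap x \o cinv x.
    by apply/funext => v; rewrite /local_rep /= diffeoK.
  have x0 : orient x p != 0.
    by apply: contraTneq oM => ->; rewrite mul0r ltxx.
  have s0 : Num.sg (\det ('J (cmap x \o cinv x) (cmap x p))) != 0.
    apply: contraNneq x0 => s0.
    by rewrite (orient_compatible ax ax xp xp) s0 mul0r.
  exact: mulfI.
by move: oN; rewrite -same_orient mulrCA pmulr_lgt0.
Qed.

End jacobian.

Lemma jacobian_inv (R : realType) n (M N : oriented_manifold R n)
    (muM : volume_form M) (muN : volume_form N) (phi : diffeomorphism M N) b :
  0 < jacobian_det muM muN phi (diffeoV phi b) ->
  jacobian_det muN muM (diffeo_inv phi) b =
  (jacobian_det muM muN phi (diffeoV phi b))^-1.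
Proof.
move=> J0; have [y [ay yb]] := atlas_cover b.
have ay' := atlas_pull_chart phi ay.
have yb' : cdom (pull_chart phi y) (diffeoV phi b) by rewrite /= diffeoVK.
have := jacobianE muM muN phi ay' yb'.
have := pull_chartK (diffeo_inv phi) y; rewrite diffeo_invK => ->.
rewrite diffeoVK => JE.
have := jacobianE muN muM (diffeo_inv phi) ay yb.
rewrite diffeo_invK JE mulrA => /esym/eqP.
rewrite -subr_eq0 -[X in _ - X]mul1r -mulrBl mulf_eq0.
rewrite (negbTE (volume_form_neq0 _ ay' yb')) orbF subr_eq0 => /eqP JV.
by rewrite -[RHS]mul1r -JV mulfK ?gt_eqF.
Qed.

(** * Comparison of volumes *)

Section volume_comparison.
Context (R : realType) (n : nat).
Implicit Types M N : oriented_manifold R n.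

Lemma measurable_continuous_map (S T : ptopologicalType) (f : S -> T) :
  continuous f -> measurable_fun setT (f : borel S -> borel T).
Proof.
move=> cf; apply: continuous_measurable_borel => [|x _]; first exact: openT.
exact: cf.
Qed.

Lemma measurable_continuous_fun (S : ptopologicalType) (f : S -> R) :
  continuous f -> measurable_fun setT (f : borel S -> measurableTypeR R).
Proof.
move=> cf; apply: continuous_measurable_R => [|x _]; first exact: openT.
exact: cf.
Qed.

Lemma measurable_preimage (S T : ptopologicalType) (f : S -> T) (B : set (borel T)) :
  continuous f -> measurable B -> measurable (f @^-1` B : set (borel S)).
Proof.
move=> cf mB; rewrite -[X in measurable X]setTI.
exact: measurable_continuous_map.
Qed.

Lemma measurable_chart_image M (x : chart R n M) (B : set (borel M)) :
  measurable B -> (B : set M) `<=` cdom x ->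
  measurable (cmap x @` B : set (borel 'rV[R]_n)).
Proof.
move=> mB Bx.
have -> : cmap x @` B = cmap x @` cdom x `&` cinv x @^-1` B.
  apply/seteqP; split => [_ [p Bp <-]|_ [[p xp <-]]] /=.
    by rewrite cmapK; [split => //; exists p => //; exact: Bx|exact: Bx].
  by rewrite cmapK// => Bp; exists p.
have mD : measurable (cmap x @` cdom x : set (borel 'rV[R]_n)).
  by apply: sub_sigma_algebra; exact: open_cmap.
have := @continuous_measurable_borel _ _ (cmap x @` cdom x) (cinv x).
by move=> /(_ (@open_cmap _ _ _ x) (@cinv_continuous _ _ _ x) mD B mB).
Qed.

Lemma measurable_chart_density M (mu : volume_form M) (x : chart R n M)
    (B : set (borel M)) :
  atlas x -> measurable B -> (B : set M) `<=` cdom x ->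
  measurable_fun (cmap x @` B : set (borel 'rV[R]_n))
    (fun v => (`|(mu : nform M) x (cinv x v) 1%:M|)%:E).
Proof.
move=> ax mB Bx.
apply: (@measurable_funS _ _ _ _ (cmap x @` cdom x : set (borel 'rV[R]_n))).
- by apply: sub_sigma_algebra; exact: open_cmap.
- exact: image_subset.
apply/measurable_EFinP; apply: continuous_measurable_R => [|v xv].
  exact: open_cmap.
apply: (@continuous_comp _ _ _ (fun v => (mu : nform M) x (cinv x v) 1%:M)).
  exact: (form_smooth (volume_form_smooth mu) 1%:M ax 0%N).
exact: norm_continuous.
Qed.

Context M N (muM : volume_form M) (muN : volume_form N).
Variable phi : diffeomorphism M N.
Let J := jacobian_det muM muN phi.

(** Both chart volumes are integrals over the same subset of R^n, and the integrands
    have ratio |J|. *)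
Lemma chart_volume_pull_le (y : chart R n N) (C : set (borel N)) (a : R) :
  atlas y -> measurable C -> (C : set N) `<=` cdom y -> 0 <= a ->
  (forall p, C (phi p) -> a <= J p) ->
  (a%:E * chart_volume muM (pull_chart phi y) (phi @^-1` C)
   <= chart_volume muN y C)%E.
Proof.
move=> ay mC Cy a0 aJ.
have ay' := atlas_pull_chart phi ay.
have mC' : measurable (phi @^-1` C : set (borel M)).
  by apply: measurable_preimage => //; exact: (diffeo_smooth phi).1.
have Cy' : (phi @^-1` C : set M) `<=` cdom (pull_chart phi y) by move=> p /Cy.
have imC : cmap (pull_chart phi y) @` (phi @^-1` C) = cmap y @` C.
  exact: image_pulled_cdom.
have mIC := measurable_chart_image mC Cy.
have md := measurable_chart_density muM ay' mC' Cy'.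
rewrite imC in md.
rewrite /chart_volume imC -ge0_integralZl_EFin//.
apply: ge0_le_integral => //.
- by move=> v _; rewrite mule_ge0// lee_fin.
- exact: measurable_funeM.
- exact: measurable_chart_density.
move=> _ [b Cb <-]; have yb := Cy _ Cb.
rewrite -EFinM lee_fin /= cmapK//.
have yb' : cdom (pull_chart phi y) (diffeoV phi b) by rewrite /= diffeoVK.
have := jacobianE muM muN phi ay' yb'; rewrite diffeoVK.
have := pull_chartK (diffeo_inv phi) y; rewrite diffeo_invK => -> ->.
rewrite normrM ler_wpM2r// (le_trans _ (ler_norm _))// aJ//.
by rewrite diffeoVK.
Qed.

(** Every decomposition that competes in the volume of phi(A) pulls back to one that
    competes in the volume of A, and the pieces are compared one by one. *)
Lemma volume_pull_le (a : R) (A : set (borel M)) :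
  measurable A -> 0 <= a -> (forall p, A p -> a <= J p) ->
  (a%:E * volume muM A <= volume muN (diffeoV phi @^-1` A))%E.
Proof.
move=> mA a0 aJ; apply: le_ereal_inf_tmp => _ [yC [yCP tyC AyC] <-].
have C_sub i p : (yC i).2 (phi p) -> A p.
  move=> Cp; have : (diffeoV phi @^-1` A) (phi p) by rewrite AyC; exists i.
  by rewrite /= diffeoK.
apply: (@le_trans _ _ (a%:E * \sum_(i <oo)
    chart_volume muM (pull_chart phi (yC i).1) (phi @^-1` (yC i).2))%E).
  rewrite lee_wpmul2l ?lee_fin//; apply: ereal_inf_lbound.
  exists (fun i => (pull_chart phi (yC i).1, phi @^-1` (yC i).2)) => //.
  split => [i||] /=.
  - have [ay mC Cy] := yCP i; split; first exact: atlas_pull_chart.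
      by apply: measurable_preimage => //; exact: (diffeo_smooth phi).1.
    by move=> p /Cy.
  - apply/trivIsetP => i j _ _ ij; apply/seteqP; split => // p [Ci Cj].
    have : ((yC i).2 `&` (yC j).2) (phi p) by [].
    by move/trivIsetP : tyC => ->.
  - rewrite -preimage_bigcup -AyC -comp_preimage.
    by rewrite (_ : diffeoV phi \o phi = id)//; apply/funext => p /=; rewrite diffeoK.
rewrite -nneseriesZl//; last first.
  by move=> i _; apply: integral_ge0 => v _; rewrite lee_fin.
apply: lee_nneseries => [i _ _|i _].
  by rewrite mule_ge0 ?lee_fin//; apply: integral_ge0 => v _; rewrite lee_fin.
have [ay mC Cy] := yCP i.
by apply: chart_volume_pull_le => // p /C_sub; exact: aJ.
Qed.

End volume_comparison.

(** * Change of variables *)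

Section change_of_variables.
Context (R : realType) (n : nat).
Implicit Types M N : oriented_manifold R n.

Lemma measurable_diffeoV M N (phi : diffeomorphism M N) :
  measurable_fun setT (diffeoV phi : borel N -> borel M).
Proof. by apply: measurable_continuous_map; exact: (diffeoV_smooth phi).1. Qed.

Lemma integral_jacobian_le M N (muM : volume_form M) (muN : volume_form N)
    (phi : diffeomorphism M N) (g : borel M -> R) :
  (forall p, 0 <= jacobian_det muM muN phi p) ->
  measurable_fun setT g -> (forall p, 0 <= g p) ->
  (\int[volume muM]_p (jacobian_det muM muN phi p * g p)%:E <=
   \int[volume muN]_b (g (diffeoV phi b))%:E)%E.
Proof.
move=> J0 mg g0; have mV := measurable_diffeoV phi.
pose nu : {measure set (borel M) -> \bar R} :=
  measure_function_pushforward__canonical__measure_function_Measure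
    (volume muN) mV.
have -> : (\int[volume muN]_b (g (diffeoV phi b))%:E = \int[nu]_p (g p)%:E)%E.
  rewrite /nu /= (ge0_integral_pushforward mV)//.
  - exact/measurable_EFinP.
  - by move=> p _; rewrite lee_fin.
apply: le_integral_density => //.
  by apply: measurable_continuous_fun; exact: jacobian_continuous.
by move=> a A mA a0 aJ; exact: volume_pull_le.
Qed.

(** One inequality is [integral_jacobian_le] for phi. The other one is the same lemma
    for the inverse of phi, applied to the function (J g) o psi: its Jacobian
    determinant 1 / J o psi cancels the factor J. *)
Lemma change_of_variables M N (muM : volume_form M) (muN : volume_form N)
    (phi : diffeomorphism M N) (g : borel M -> R) :
  (forall p, 0 < jacobian_det muM muN phi p) ->
  measurable_fun setT g -> (forall p, 0 <= g p) ->
  (\int[volume muN]_b (g (diffeoV phi b))%:E =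
   \int[volume muM]_p (jacobian_det muM muN phi p * g p)%:E)%E.
Proof.
set J := jacobian_det muM muN phi => J0 mg g0.
have mJ : measurable_fun setT (J : borel M -> R).
  by apply: measurable_continuous_fun; exact: jacobian_continuous.
apply/eqP; rewrite eq_le; apply/andP; split; last first.
  by apply: integral_jacobian_le => // p; exact: ltW.
pose h (b : borel N) := J (diffeoV phi b) * g (diffeoV phi b).
have mV := measurable_diffeoV phi.
have := @integral_jacobian_le _ _ muN muM (diffeo_inv phi) h.
have -> : (\int[volume muM]_p (h (diffeoV (diffeo_inv phi) p))%:E =
    \int[volume muM]_p (J p * g p)%:E)%E.
  by apply: eq_integral => p _; rewrite /h /= diffeoK.
have Jinv := jacobian_inv (J0 (diffeoV phi _)).
rewrite (eq_integral (fun b : borel N => (g (diffeoV phi b))%:E)); last first.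
  by move=> b _; rewrite Jinv /h mulKf// gt_eqF.
apply.
- by move=> b; rewrite Jinv invr_ge0 ltW.
- exact: measurable_funM (measurableT_comp mJ mV) (measurableT_comp mg mV).
- by move=> b; rewrite mulr_ge0// ltW.
Qed.

Lemma volume_null_pull M N (muM : volume_form M) (muN : volume_form N)
    (phi : diffeomorphism M N) (A : set (borel M)) :
  (forall p, 0 < jacobian_det muM muN phi p) -> measurable A ->
  volume muM A = 0%E -> volume muN (diffeoV phi @^-1` A) = 0%E.
Proof.
set J := jacobian_det muM muN phi => J0 mA A0.
have mJ : measurable_fun setT (J : borel M -> R).
  by apply: measurable_continuous_fun; exact: jacobian_continuous.
have mVA : measurable (diffeoV phi @^-1` A : set (borel N)).
  by rewrite -[X in measurable X]setTI; exact: measurable_diffeoV.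
rewrite -[X in volume muN X]setIT -integral_indic//.
have m1A : measurable_fun setT (\1_A : borel M -> R) by exact: measurable_indic.
rewrite (change_of_variables J0 m1A)//.
rewrite (eq_integral ((fun p => (J p)%:E) \_ A)); last first.
  by move=> p _; rewrite patchE indicE; case: ifP; rewrite ?mulr1 ?mulr0.
rewrite -integral_mkcond null_set_integral//.
exact/measurable_EFinP/measurable_funTS.
Qed.

Lemma Lnormy_pull_le M N (muM : volume_form M) (muN : volume_form N)
    (phi : diffeomorphism M N) (w : M -> R) :
  (forall p, 0 < jacobian_det muM muN phi p) ->
  ('N[volume muN]_+oo[EFin \o (w \o diffeoV phi)] <=
   'N[volume muM]_+oo[EFin \o w])%E.
Proof.
move=> J0; rewrite [in leLHS]unlock; case: ifPn => [_|_]; last exact: Lnorm_ge0.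
apply/ess_supP; have [A [mA A0 wA]] := ae_le_Lnormy (volume muM) (EFin \o w).
exists (diffeoV phi @^-1` A); split.
- by rewrite -[X in measurable X]setTI; exact: measurable_diffeoV.
- exact: (volume_null_pull J0).
- by move=> b; exact: wA.
Qed.

Lemma Lnormy_pull M N (muM : volume_form M) (muN : volume_form N)
    (phi : diffeomorphism M N) (w : M -> R) :
  (forall p, 0 < jacobian_det muM muN phi p) ->
  ('N[volume muN]_+oo[EFin \o (w \o diffeoV phi)] =
   'N[volume muM]_+oo[EFin \o w])%E.
Proof.
move=> J0; apply/eqP; rewrite eq_le Lnormy_pull_le//=.
have := @Lnormy_pull_le _ _ muN muM (diffeo_inv phi) (w \o diffeoV phi).
have -> : (w \o diffeoV phi) \o diffeoV (diffeo_inv phi) = w.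
  by apply/funext => p /=; rewrite diffeoK.
by apply=> b; rewrite jacobian_inv// invr_gt0.
Qed.

End change_of_variables.

(** * Norms of densities *)

Section density_norms.
Context (R : realType) (n : nat) (M N : oriented_manifold R n).
Context (muM : volume_form M) (muN : volume_form N) (phi : diffeomorphism M N).
Let J := jacobian_det muM muN phi.
Hypothesis J_gt0 : forall p, 0 < J p.

Lemma form_ratio_pushforward (u : M -> R) :
  form_ratio (pushforward_form phi (mul_form u muM)) muN =
  (fun a => u a / J a) \o diffeoV phi.
Proof.
apply: form_ratioE => y b ay yb; apply/funext => A.
have := jacobianP muN muM (diffeo_inv phi) ay yb.
move=> /(congr1 (fun h => u (diffeoV phi b) * h A)).
by rewrite /mul_form /= jacobian_inv// mulrA.
Qed.

Lemma density_norm_mul_form (p : \bar R) (u : M -> R) :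
  density_norm muM p (mul_form u muM) = 'N[volume muM]_p[EFin \o u]%E.
Proof. by rewrite /density_norm (@form_ratioE _ _ _ muM _ u). Qed.

Lemma conjugate_exponent (r : R) (q : \bar R) : 1 <= r ->
  (r%:E^-1 + q^-1 = 1)%E -> fine (q^-1)%E = 1 - r^-1.
Proof.
move=> r1; rewrite inver gt_eqF ?(lt_le_trans ltr01)//.
by case: (q^-1)%E => [s [<-]| |]//=; rewrite addrAC subrr add0r.
Qed.

(** For finite p the exponents combine as J J^(-p) = J^(1-p) = (J^(-1/q))^p. *)
Lemma density_norm_pushforward (p q : \bar R) (u : borel M -> R) :
  measurable_fun setT u -> (1 <= p)%E -> (p^-1 + q^-1 = 1)%E ->
  density_norm muN p (pushforward_form phi (mul_form u muM)) =
  'N[volume muM]_p[EFin \o (fun a => u a * J a `^ (- fine (q^-1)%E))%R]%E.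
Proof.
move=> mu p1 pq; rewrite /density_norm form_ratio_pushforward.
have mJ : measurable_fun setT (J : borel M -> R).
  by apply: measurable_continuous_fun; exact: jacobian_continuous.
case: p p1 pq => [r| |//] r1 pq; last first.
  rewrite invey add0e in pq; rewrite pq (Lnormy_pull _ J_gt0).
  by congr Lnorm; apply/funext => a /=; rewrite powR_inv1 ?ltW.
rewrite lee_fin in r1; rewrite (conjugate_exponent r1 pq).
have r0 : r != 0 by rewrite gt_eqF// (lt_le_trans ltr01).
rewrite unlock; congr poweR.
transitivity (\int[volume muN]_b ((fun a => `|u a / J a| `^ r) (diffeoV phi b))%:E)%E.
  by apply: eq_integral.
rewrite (@change_of_variables _ _ _ _ muM muN phi (fun a => `|u a / J a| `^ r))//.
- apply: eq_integral => a _; rewrite [RHS]poweR_EFin; congr EFin.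
  have Ja := J_gt0 a; rewrite !normrM normfV (gtr0_norm Ja).
  rewrite (ger0_norm (powR_ge0 _ _)) !powRM ?invr_ge0 ?(ltW Ja) ?powR_ge0//.
  rewrite mulrCA; congr (_ * _).
  have JE : J a = J a `^ 1 by rewrite powRr1 ?ltW.
  rewrite -(powR_inv1 (ltW Ja)) -!powRrM [X in X * _]JE.
  rewrite -powRD ?(lt0r_neq0 Ja) ?implybT//; congr (_ `^ _).
  by rewrite opprB mulrBl mulVf// mul1r mulN1r.
- apply: (measurableT_comp (measurable_powR r)).
  apply: measurableT_comp => //; apply: measurable_funM => //.
  apply: measurable_continuous_fun => a; apply: cvgV; first exact: lt0r_neq0.
  exact: jacobian_continuous.
Qed.

End density_norms.

(** The degenerate constants: for c = 0 the hypothesis forces x <= 0, and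
    0^-1 = +oo times x is then at most 0; for c = +oo the left-hand side is 0. *)
Lemma lee_inv_mul (R : realType) (x y c : \bar R) :
  (0 <= y)%E -> (0 <= c)%E -> (x <= c * y)%E -> (c^-1 * x <= y)%E.
Proof.
move=> y0; case: c => [c| |//] c0 xcy; last by rewrite invey mul0e.
rewrite lee_fin in c0; rewrite inver; case: eqVneq => [cE|cN0].
  rewrite cE mul0e in xcy; apply: le_trans y0.
  by rewrite mule_ge0_le0 ?leey.
by rewrite lee_pdivrMl// lt0r cN0.
Qed.

Lemma measurable_form_support (R : realType) n (M : manifold R n) (eta : nform M) :
  measurable (form_support eta : set (borel M)).
Proof.
rewrite -[X in measurable X]setCK; apply: measurableC.
by apply: sub_sigma_algebra; exact/closed_openC/closed_closure.
Qed.

(** A volume form vanishes nowhere, so u can only be nonzero on the support of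
    u mu. *)
Lemma indic_form_support (R : realType) n (M : oriented_manifold R n)
    (mu : volume_form M) (u : M -> R) a :
  \1_(form_support (mul_form u mu)) a * u a = u a.
Proof.
have [->|u0] := eqVneq (u a) 0; first by rewrite mulr0.
rewrite indicE mem_set ?mul1r//; apply: subset_closure.
have [x [ax xa]] := atlas_cover a; exists x, 1%:M; split => //.
by rewrite /mul_form mulf_neq0// volume_form_neq0.
Qed.

Unset Implicit Arguments.

Theorem theorem3 (R : realType) (n : nat) (M N : oriented_manifold R n)
    (muM : volume_form M) (muN : volume_form N) (phi : diffeomorphism M N)
    (u : M -> R) (p q : \bar R) :
  orientation_preserving phi ->
  smooth_fun u ->
  compact (closure [set a | u a != 0]) ->
  (1 <= p)%E -> (1 <= q)%E -> (p^-1 + q^-1 = 1)%E ->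
  let J : M -> R := jacobian_det muM muN phi in
  let omega : nform M := mul_form u muM in
  let S : set M := form_support omega in
  let q' : R := fine (q^-1)%E in
  (((sup_norm muM (fun a => \1_S a * J a `^ q')%R)^-1 * density_norm muM p omega
    <= density_norm muN p (pushforward_form phi omega))%E /\
   (density_norm muN p (pushforward_form phi omega)
    <= sup_norm muM (fun a => \1_S a * J a `^ (- q'))%R
       * density_norm muM p omega)%E).
Proof.
move=> op su _ p1 _ pq J omega S q'.
have J0 a : 0 < J a by exact: jacobian_gt0.
have mu : measurable_fun setT (u : borel M -> R).
  by apply: measurable_continuous_fun; exact: smooth_fun_continuous.
have mJ : measurable_fun setT (J : borel M -> R).
  by apply: measurable_continuous_fun; exact: jacobian_continuous.
have mJpow r : measurable_fun setT ((fun a => J a `^ r) : borel M -> R).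
  exact: (measurableT_comp (measurable_powR r)).
have m1J r : measurable_fun setT ((fun a => \1_S a * J a `^ r) : borel M -> R).
  apply: measurable_funM => //; apply: measurable_indic.
  exact: measurable_form_support.
have p0 : (0 < p)%E by rewrite (lt_le_trans _ p1).
rewrite (density_norm_pushforward J0 mu p1 pq) -/q' density_norm_mul_form.
split; last first.
  rewrite /sup_norm; apply: (le_trans _ (Lnorm_mul_le (volume muM) p0 (m1J (- q')) mu)).
  rewrite le_eqVlt; apply/orP; left; apply/eqP; congr Lnorm.
  by apply/funext => a /=; rewrite mulrAC indic_form_support.
apply: lee_inv_mul; try exact: Lnorm_ge0.
rewrite /sup_norm.
have muJ := measurable_funM mu (mJpow (- q')).
apply: (le_trans _ (Lnorm_mul_le (volume muM) p0 (m1J q') muJ)).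
rewrite le_eqVlt; apply/orP; left; apply/eqP; congr Lnorm.
apply/funext => a /=; congr EFin.
rewrite mulrACA indic_form_support powRN mulfV ?mulr1//.
by rewrite gt_eqF// powR_gt0.
Qed.
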